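(* Let $\alpha>0$, let $n$ be a positive integer, let $\lambda\in\overline{\mathbb{D}}$, and let $\phi(z)=Az$ for $z\in\mathbb{C}^n$, where $A=\lambda I$ is the $n\times n$ scalar matrix. Then the Berezin range of the composition operator $C_\phi$ acting on the Fock space $\mathcal{F}^2_\alpha(\mathbb{C}^n)$ is convex if and only if $\lambda\in[-1,1]$.
   Context: $\overline{\mathbb D}$ is the closed unit disc in $\mathbb C$. For $\alpha>0$, the Fock space $\mathcal F^2_\alpha(\mathbb C^n)$ is the Hilbert space of holomorphic functions $f$ on $\mathbb C^n$ with $\int_{\mathbb C^n}|f|^2\,dv_\alpha<\infty$, with inner product $\langle f,g\rangle_\alpha=\int_{\mathbb{C}^n} f\overline g\,dv_\alpha$, where $dv_\alpha(z)=(\alpha/\pi)^ne^{-\alpha|z|^2}dv(z)$ is the Gaussian probability measure ($dv$ is Lebesgue volume measure). It is a reproducing kernel Hilbert space with kernel $k_w(z)=e^{\alpha\langle z,w\rangle}$, $\langle z,w\rangle=\sum_{i=1}^nz_i\overline{w_i}$, and $\|k_w\|^2=e^{\alpha|w|^2}$. $C_\phi f=f\circ\phi$. With $\hat k_w=k_w/\|k_w\|$, the Berezin range of a bounded operator $T$ is $\mathrm{Ber}(T)=\{\langle T\hat k_w,\hat k_w\rangle:w\in\mathbb C^n\}\subset\mathbb C$. *)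

(* Defs.v *)
From HB Require Import structures.
From mathcomp Require Import all_boot all_order all_algebra.
From mathcomp Require Import all_classical all_reals all_analysis.
From mathcomp Require Export complex.
Set Implicit Arguments.
Unset Strict Implicit.
Unset Printing Implicit Defensive.
Import Order.TTheory GRing.Theory Num.Theory.
Import numFieldNormedType.Exports.
Local Open Scope classical_set_scope.
Local Open Scope complex_scope.
Local Open Scope ring_scope.

Section tuple_measure.
Context d (T : measurableType d) (R : realType).
Variable m : {sigma_finite_measure set T -> \bar R}.

Definition tcons n (p : T * n.-tuple T) : n.+1.-tuple T := [tuple of p.1 :: p.2].

Let measurable_tcons n : measurable_fun [set: T * n.-tuple T] (@tcons n).
Proof. by apply: measurable_cons; [exact: measurable_fst|exact: measurable_snd]. Qed.

HB.instance Definition _ n := isMeasurableFun.Build _ _ _ _ (@tcons n)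
  (@measurable_tcons n).

Section cons.
Variables (n : nat) (mu : {sigma_finite_measure set (n.-tuple T) -> \bar R}).

Definition cons_measure : set (n.+1.-tuple T) -> \bar R :=
  pushforward (m \x mu)%E (@tcons n).

Let cons_measure0 : cons_measure set0 = 0%E.
Proof. exact: measure0. Qed.

Let cons_measure_ge0 A : (0 <= cons_measure A)%E.
Proof. exact: measure_ge0. Qed.

Let cons_measure_additive : semi_sigma_additive cons_measure.
Proof. exact: measure_semi_sigma_additive. Qed.

HB.instance Definition _ := isMeasure.Build _ _ _ cons_measure
  cons_measure0 cons_measure_ge0 cons_measure_additive.

Let cons_measure_sigma_finite : sigma_finite setT cons_measure.
Proof.
have /sigma_finiteP[F [FT ndF Foo]] := sigma_finiteT m.
have /sigma_finiteP[G [GT ndG Goo]] := sigma_finiteT mu.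
pose uncons (t : n.+1.-tuple T) : T * n.-tuple T :=
  (thead t, [tuple of behead t]).
have tconsK : cancel (@tcons n) uncons.
  by move=> [x t]; congr pair; rewrite ?theadE//; apply: val_inj.
have munc : measurable_fun setT uncons.
  by apply/measurable_fun_pairP; split;
    [exact: measurable_tnth|exact: measurable_behead].
exists (fun i => uncons @^-1` (F i `*` G i)).
  rewrite -preimage_bigcup (_ : \bigcup_i _ = setT) ?preimage_setT//.
  rewrite -subTset => -[x t] _.
  have [k _ Fx] : (\bigcup_i F i) x by rewrite -FT.
  have [l _ Gt] : (\bigcup_i G i) t by rewrite -GT.
  exists (maxn k l) => //; split => /=.
  - by move: x Fx; exact/subsetPset/ndF/leq_maxl.
  - by move: t Gt; exact/subsetPset/ndG/leq_maxr.
move=> i; have [mF Fi] := Foo i; have [mG Gi] := Goo i; split.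
  by rewrite -[X in measurable X]setTI; apply: munc => //; exact: measurableX.
rewrite /cons_measure /pushforward -comp_preimage.
rewrite (_ : uncons \o _ = id); last by apply/funext => p; exact: tconsK.
by rewrite preimage_id product_measure1E// lte_mul_pinfty// ge0_fin_numE.
Qed.

HB.instance Definition _ := Measure_isSigmaFinite.Build _ _ _ cons_measure
  cons_measure_sigma_finite.

End cons.

(* the n-fold product measure m \x ... \x m *)
Fixpoint tuple_measure n : {sigma_finite_measure set (n.-tuple T) -> \bar R} :=
  match n with
  | 0 => \d_[tuple]
  | n'.+1 => cons_measure (tuple_measure n')
  end.

End tuple_measure.

Section fock_space.
Context {R : realType}.
Local Notation C := R[i].

(* Lebesgue volume measure on C^n = R^(2n), where z_j = x_j + i y_j has real
   coordinates (x_1, ..., x_n, y_1, ..., y_n) *)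
Definition volume n :
    {sigma_finite_measure set ((n + n).-tuple (measurableTypeR R)) -> \bar R} :=
  tuple_measure (@lebesgue_measure R) (n + n).

Definition of_real_coords n (t : (n + n).-tuple (measurableTypeR R)) :
    'cV[C]_n :=
  \col_j (tnth t (lshift n j) +i* tnth t (rshift n j)).

Definition expC (z : C) : C :=
  (expR (complex.Re z))%:C * (cos (complex.Im z) +i* sin (complex.Im z)).

Definition cdot n (z w : 'cV[C]_n) : C := \sum_i z i 0 * (w i 0)^*.

(* |z|^2; the norm `|z| provided by the library on 'cV[C]_n is the max norm *)
Definition sqnorm n (z : 'cV[C]_n) : R := complex.Re (cdot z z).

Section fixed_weight.
Variables (alpha : R) (n : nat).
Local Notation Cn := 'cV[C]_n.

Definition gauss_density (z : Cn) : R :=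
  (alpha / pi) ^+ n * expR (- alpha * sqnorm z).

(* integrals against dv_alpha; the first one has values in [0, +oo] *)
Definition gauss_integral_ge0 (g : Cn -> R) : \bar R :=
  (\int[volume n]_t (g (of_real_coords t) *
     gauss_density (of_real_coords t))%:E)%E.

Definition gauss_integral (g : Cn -> C) : C :=
  (\int[volume n]_t (complex.Re (g (of_real_coords t)) *
     gauss_density (of_real_coords t)))%R
  +i*
  (\int[volume n]_t (complex.Im (g (of_real_coords t)) *
     gauss_density (of_real_coords t)))%R.

(* Both normed modules are over the scalar field C, so differentiable means
   holomorphic.  `|f z| is a complex number with zero imaginary part. *)
Definition fock_space : set (Cn -> C) :=
  [set f : Cn -> C | (forall z, differentiable (f : Cn -> C^o) z) /\
    (gauss_integral_ge0 (fun z => (complex.Re `|f z|%R ^+ 2)%R) < +oo)%E].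

Lemma fock_space0 : (fun=> 0) \in fock_space.
Proof.
rewrite inE; split; first by move=> z; exact: differentiable_cst.
rewrite /gauss_integral_ge0 integral0_eq// => t _.
by rewrite normr0 expr0n mul0r.
Qed.

Definition fock_inner (f g : fock_space) : C :=
  gauss_integral (fun z => val f z * (val g z)^*).

Definition fock_norm (f : fock_space) : R :=
  Num.sqrt (complex.Re (fock_inner f f)).

(* The element of the Fock space with underlying function f; the default value
   0 is taken only when f does not belong to the space. *)
Definition to_fock (f : Cn -> C) : fock_space :=
  insubd (exist (fun g => g \in fock_space) _ fock_space0 : fock_space) f.

Definition fock_kernel (w : Cn) : fock_space :=
  to_fock (fun z => expC (alpha%:C * cdot z w)).

Definition normalized_kernel (w : Cn) : fock_space :=
  to_fock (fun z => val (fock_kernel w) z / (fock_norm (fock_kernel w))%:C).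

Definition berezin_range (T : fock_space -> fock_space) : set C :=
  [set fock_inner (T (normalized_kernel w)) (normalized_kernel w)
     | w in [set: Cn]].

(* C_phi f = f \o phi.  For phi linear with operator norm at most 1, f \o phi
   belongs to the Fock space for every f in it, so the default value of to_fock
   is not used. *)
Definition composition_operator (phi : Cn -> Cn) (f : fock_space) : fock_space :=
  to_fock (val f \o phi).

End fixed_weight.
End fock_space.

(* Main.v *)
Require Import Defs.
From HB Require Import structures.
From mathcomp Require Import all_boot all_order all_algebra.
From mathcomp Require Import all_classical all_reals all_analysis.
From mathcomp Require Import complex.
From mathcomp Require Import measurable_realfun ring lra.
Set Implicit Arguments.
Unset Strict Implicit.
Unset Printing Implicit Defensive.
Import Order.TTheory GRing.Theory Num.Theory.
Import numFieldNormedType.Exports.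
Local Open Scope classical_set_scope.
Local Open Scope complex_scope.
Local Open Scope ring_scope.

(** The Berezin transform of the composition operator is computed explicitly, and
   the theorem is then a statement about a curve in the plane.

   The kernel k_w is the function z |-> exp (alpha <z, w>), and composition with
   z |-> lambda z turns it into the kernel at conj lambda w.  By the reproducing
   property <C_phi k_w, k_w> = exp (alpha lambda |w|^2), and division by the
   squared norm exp (alpha |w|^2) of k_w shows that the Berezin range is the curve
   exp (r (lambda - 1)), r >= 0 ([berezin_range_scalar]).  If lambda is a real
   number t <= 1, the curve is the singleton {1} or the interval ]0, 1], and both
   are convex ([convex_exp_real_ray]).  If lambda is not real, the curve winds
   around 0 without passing through it: it contains 1 and a negative real number,
   but not the point 0 of the segment between them ([nonconvex_spiral]).

   Since all functions involved are multiples of exponentials, the reproducing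
   property is needed for exponentials only, where it is a Gaussian integral over
   C^n.  In the 2n real coordinates the integrand is a product of functions of one
   variable ([fock_integrand_prod]), so by Fubini ([Cintegral_tuple_prod]) it is
   enough to integrate exp (c x - alpha x^2) over the line for complex c
   ([Cintegral_gauss_exp]).  After completion of the square this is the
   characteristic function of a normal law ([normal_charfun_center]), which solves
   a first-order linear differential equation: differentiation under the integral
   sign followed by an integration by parts ([normal_Stein_sin]).  Membership of
   the exponentials in the Fock space further requires that the complex
   exponential be holomorphic ([derivable_expC]). *)

(** * Real and imaginary parts *)

Lemma ImD (R : rcfType) (x y : R[i]) :
  complex.Im (x + y) = complex.Im x + complex.Im y.
Proof. by case: x y => ? ? [? ?]. Qed.

Lemma ReD (R : rcfType) (x y : R[i]) :
  complex.Re (x + y) = complex.Re x + complex.Re y.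
Proof. by case: x y => ? ? [? ?]. Qed.

Lemma ReB (R : rcfType) (x y : R[i]) :
  complex.Re (x - y) = complex.Re x - complex.Re y.
Proof. by case: x y => ? ? [? ?]. Qed.

Lemma ImB (R : rcfType) (x y : R[i]) :
  complex.Im (x - y) = complex.Im x - complex.Im y.
Proof. by case: x y => ? ? [? ?]. Qed.

Lemma ReM (R : rcfType) (x y : R[i]) :
  complex.Re (x * y) = complex.Re x * complex.Re y - complex.Im x * complex.Im y.
Proof. by case: x y => ? ? [? ?]. Qed.

Lemma ImM (R : rcfType) (x y : R[i]) :
  complex.Im (x * y) = complex.Re x * complex.Im y + complex.Im x * complex.Re y.
Proof. by case: x y => ? ? [? ?]. Qed.

Lemma mulc_conj (R : rcfType) (z : R[i]) :
  z * (z^*)%C = (complex.Re z ^+ 2 + complex.Im z ^+ 2)%:C.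
Proof.
case: z => a b; apply/eqP; rewrite eq_complex ReM ImM /=.
by apply/andP; split; apply/eqP; ring.
Qed.

(** Stated for the function conjc itself: a rewrite with the generic morphism law
   would leave a packaged morphism, which ring does not recognise. *)
Lemma conjcM (R : rcfType) (x y : R[i]) : ((x * y)^*)%C = (x^*)%C * (y^*)%C.
Proof. exact: rmorphM. Qed.

(** The notation for conjugation resolves to the operation of numerically closed
   fields in some statements and to conjc in others. *)
Lemma conjCE (R : rcfType) (x : R[i]) : x^* = (x^*)%C.
Proof. by []. Qed.

(** * The fundamental theorem of calculus on the real line *)

(** The integrals over [-n, n] are F n - F (-n); since f may change sign, they are
   shown to converge by dominated convergence, with dominating function |f|. *)
Lemma integrable_FTC2_line (R : realType) (F f : R -> R) (l m : R) :
  continuous f -> (forall x : R, is_derive x 1 F (f x)) ->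
  (@lebesgue_measure R).-integrable [set: R] (EFin \o f) ->
  F x @[x --> -oo] --> m -> F x @[x --> +oo] --> l ->
  \int[@lebesgue_measure R]_x f x = l - m.
Proof.
move=> cf dF intf Fm Fl; pose mu := @lebesgue_measure R.
have cF : continuous F.
  move=> x; apply/differentiable_continuous/derivable1_diffP.
  by apply: ex_derive; exact: dF.
pose I n := `[- n.+1%:R, n.+1%:R]%classic : set R.
have mI n : measurable (I n) by exact: measurable_itv.
have mf := measurable_int _ intf.
have g0 : {ae mu, forall x : measurableTypeR R, [set: R] x ->
    (fun n => ((EFin \o f) \_ (I n)) x) @ \oo --> (EFin \o f) x}.
  apply: aeW => x _; apply: cvg_near_cst.
  near=> n; rewrite patchE mem_set//= /I /= in_itv/=.
  rewrite -ler_norml; apply: (@le_trans _ _ n%:R); last by rewrite ler_nat.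
  near: n; exact: nbhs_infty_ger.
have g1 : {ae mu, forall (x : measurableTypeR R) n, [set: R] x ->
    (`|((EFin \o f) \_ (I n)) x| <= (abse \o (EFin \o f)) x)%E}.
  apply: aeW => x n _.
  by rewrite patchE /=; case: ifP => _ /=; rewrite lee_fin ?normr0.
have mr n : measurable_fun [set: R] ((EFin \o f) \_ (I n)).
  apply: (@measurable_restrictT _ _ _ _ _ _ (mI n)).1.
  by apply: (@measurable_funS _ _ _ _ _ _ _ measurableT) mf.
have [_ _ cvgI] := @dominated_convergence _ (measurableTypeR R) R mu _
  measurableT _ _ _ mr mf g0
  (integrable_abse intf) g1.
have E n : (\int[mu]_x ((EFin \o f) \_ (I n)) x =
    (F n.+1%:R - F (- n.+1%:R))%:E)%E.
  rewrite -integral_mkcond /=.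
  apply: continuous_FTC2.
  - by rewrite gtrN// ltr0n.
  - exact: continuous_subspaceT.
  - split => [x _||].
    + by apply: ex_derive; exact: dF.
    + exact/cvg_at_right_filter/cF.
    + exact/cvg_at_left_filter/cF.
  - by move=> x _; rewrite derive1E; apply: derive_val; exact: dF.
have {}cvgI : F n.+1%:R - F (- n.+1%:R) @[n --> \oo] --> \int[mu]_x f x.
  have /fine_cvg : (F n.+1%:R - F (- n.+1%:R))%:E @[n --> \oo] -->
      (\int[mu]_x f x)%:E.
    rewrite /Rintegral fineK; last exact: integrable_fin_num.
    by under eq_fun do rewrite -E.
  by [].
apply: (cvg_unique _ cvgI) => //.
have yn : (n.+1%:R : R) @[n --> \oo] --> +oo.
  by rewrite (@cvg_shiftS _ (fun n => n%:R : R)); exact: cvgr_idn.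
apply: cvgB; first exact: (cvg_comp _ _ yn Fl).
apply: (cvg_comp (fun n : nat => - (n.+1%:R : R)) F _ Fm).
by apply/(@cvgNrNy _ _ _ _ (fun n : nat => n.+1%:R : R)).
Unshelve. all: by end_near. Qed.

(** * Normal densities *)

(** Completing the square: an exponential factor shifts the mean. *)
Lemma normal_pdf_tilt (R : realType) (m s c x : R) : s != 0 ->
  normal_pdf m s x * expR (c * x) =
  expR (c * m + c ^+ 2 * s ^+ 2 / 2) * normal_pdf (m + c * s ^+ 2) s x.
Proof.
move=> s0; rewrite !normal_pdfE// /normal_fun -!mulrA -expRD mulrCA -expRD.
by congr (_ * expR _); field.
Qed.

Lemma integrable_normal_pdfM (R : realType) (m s : R) (h : R -> R) :
  measurable_fun [set: R] h -> (forall x, `|h x| <= 1) ->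
  (@lebesgue_measure R).-integrable [set: R]
    (EFin \o (fun x => normal_pdf m s x * h x)).
Proof.
move=> mh h1; apply: le_integrable (integrable_normal_pdf m s) => //.
  by apply/measurable_EFinP/measurable_funM => //; exact: measurable_normal_pdf.
by move=> x _ /=; rewrite lee_fin normrM ler_piMr.
Qed.

(** From |y| <= exp y + exp (- y): by [normal_pdf_tilt] both exponentials turn the
   density into a multiple of another normal density. *)
Lemma integrable_normal_moment (R : realType) (m s : R) : s != 0 ->
  (@lebesgue_measure R).-integrable [set: R]
    (EFin \o (fun x => normal_pdf m s x * `|x - m|)).
Proof.
move=> s0.
have I c : (@lebesgue_measure R).-integrable [set: R]
    (fun x => (expR (c * m + c ^+ 2 * s ^+ 2 / 2)
       * normal_pdf (m + c * s ^+ 2) s x)%:E).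
  under eq_fun do rewrite EFinM.
  by apply: integrableZl => //; exact: integrable_normal_pdf.
have J c : (@lebesgue_measure R).-integrable [set: R]
    (fun x => (normal_pdf m s x * expR (c * x) * expR (- (c * m)))%:E).
  under eq_fun do rewrite normal_pdf_tilt// mulrC EFinM.
  by apply: integrableZl => //; exact: I.
apply: le_integrable (integrableD _ (J 1) (J (-1))) => //.
  apply/measurable_EFinP/measurable_funM; first exact: measurable_normal_pdf.
  apply: measurableT_comp => //; exact: measurable_funB.
move=> x _ /=; rewrite lee_fin -!mulrA -!expRD -mulrDr !normrM.
rewrite ler_wpM2l// normr_id [leRHS]ger0_norm ?addr_ge0 ?expR_ge0//.
have e y : y <= expR y.
  by apply: le_trans (expR_ge1Dx y); rewrite lerDr.
rewrite ler_norml; apply/andP; split.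
  rewrite lerNl opprB; apply: (@le_trans _ _ (expR (m - x))); first exact: e.
  by rewrite (_ : -1 * x - -1 * m = m - x) ?lerDr ?expR_ge0//; ring.
apply: (@le_trans _ _ (expR (x - m))); first exact: e.
by rewrite !mul1r lerDl expR_ge0.
Qed.

Lemma is_derive_normal_pdf (R : realType) (m s x : R) : s != 0 ->
  is_derive x 1 (normal_pdf m s) (- (x - m) / s ^+ 2 * normal_pdf m s x).
Proof.
move=> s0; rewrite !normal_pdfE// /normal_fun.
apply: is_derive_eq.
by rewrite /GRing.scale /= -[s ^+ 2 *+ 2]mulr_natr; field.
Qed.

Lemma cvg_normal_pdf (R : realType) (m s : R) : s != 0 ->
  normal_pdf m s x @[x --> +oo] --> 0.
Proof.
move=> s0; rewrite normal_pdfE// -[X in _ --> X](mulr0 (normal_peak s)).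
apply: cvgM; first exact: cvg_cst.
have s2 : 0 < (s ^+ 2 *+ 2)^-1.
  by rewrite invr_gt0 pmulrn_lgt0// exprn_even_gt0.
have y2 : (x - m) ^+ 2 * (s ^+ 2 *+ 2)^-1 @[x --> +oo] --> +oo.
  apply/gt0_cvgMly => //.
  apply: (cvg_comp (fun x => x - m) (fun x => x ^+ 2)); last exact: cvgr_expr2.
  exact: cvg_addrr.
rewrite /normal_fun; under eq_fun do rewrite mulNr.
exact: (cvg_comp _ (fun x => expR (- x)) y2 (@cvgr_expR R)).
Qed.

Lemma cvgNy_normal_pdf (R : realType) (m s : R) : s != 0 ->
  normal_pdf m s x @[x --> -oo] --> 0.
Proof.
move=> s0; apply/cvgNy_compNP => /=.
rewrite (_ : (fun x => _) = normal_pdf (- m) s); first exact: cvg_normal_pdf.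
apply/funext => x; rewrite !normal_pdfE// /normal_fun /=.
by rewrite -opprD sqrrN opprK.
Qed.

(** * The characteristic function of a normal law *)

Lemma norm_cos_le1 (R : realType) (x : R) : `|cos x| <= 1.
Proof. by rewrite ler_norml cos_geN1 cos_le1. Qed.

Lemma norm_sin_le1 (R : realType) (x : R) : `|sin x| <= 1.
Proof. by rewrite ler_norml sin_geN1 sin_le1. Qed.

Lemma measurable_cos_comp (R : realType) (f : R -> R) :
  measurable_fun [set: R] f -> measurable_fun [set: R] (fun x => cos (f x)).
Proof.
apply: measurableT_comp; apply: continuous_measurable_fun.
exact: continuous_cos.
Qed.

Lemma measurable_sin_comp (R : realType) (f : R -> R) :
  measurable_fun [set: R] f -> measurable_fun [set: R] (fun x => sin (f x)).
Proof.
apply: measurableT_comp; apply: continuous_measurable_fun.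
exact: continuous_sin.
Qed.

Lemma cvg0M_bounded (R : realType) (F : set_system R) (p h : R -> R) :
  Filter F -> (forall x, `|h x| <= 1) ->
  p x @[x --> F] --> 0 -> p x * h x @[x --> F] --> 0.
Proof.
move=> FF h1 p0; apply: norm_cvg0.
have p0' : `|p x| @[x --> F] --> 0 by rewrite -(@normr0 R R); exact: cvg_norm.
apply: (@squeeze_cvgr _ _ _ _ (cst 0) _ _ _ _ _ p0'); last exact: cvg_cst.
by apply: nearW => x /=; rewrite normr_ge0/= normrM ler_piMr.
Qed.

Lemma integrable_normal_momentM (R : realType) (m s : R) (h : R -> R) :
  s != 0 -> measurable_fun [set: R] h -> (forall x, `|h x| <= 1) ->
  (@lebesgue_measure R).-integrable [set: R]
    (EFin \o (fun x => normal_pdf m s x * (x - m) * h x)).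
Proof.
move=> s0 mh h1; apply: le_integrable (integrable_normal_moment m s0) => //.
  apply/measurable_EFinP/measurable_funM => //.
  by apply: measurable_funM; [exact: measurable_normal_pdf|exact: measurable_funB].
by move=> x _ /=; rewrite lee_fin !normrM normr_id ler_piMr// mulr_ge0.
Qed.

(** Integration by parts: the derivative of the density at x is
   - (x - m) / s ^+ 2 times the density, so the two sides differ by s ^+ 2 times
   the integral of the derivative of density * sine, which is 0 because the
   density vanishes at both ends. *)
Lemma normal_Stein_sin (R : realType) (m s b t : R) : s != 0 ->
  \int[@lebesgue_measure R]_x
    (normal_pdf m s x * (x - m) * sin (b * (x - m) + t)) =
  s ^+ 2 * b *
  \int[@lebesgue_measure R]_x (normal_pdf m s x * cos (b * (x - m) + t)).
Proof.
move=> s0.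
pose F x := normal_pdf m s x * sin (b * (x - m) + t).
pose f x := b * (normal_pdf m s x * cos (b * (x - m) + t))
  - s ^- 2 * (normal_pdf m s x * (x - m) * sin (b * (x - m) + t)).
have dl (x : R) : is_derive x 1 (fun x => b * (x - m) + t) b.
  by apply: is_derive_eq; rewrite /GRing.scale /=; ring.
have dF (x : R) : is_derive x 1 F (f x).
  have dp := is_derive_normal_pdf m x s0.
  have ds := @is_derive1_comp _ sin (fun x => b * (x - m) + t) x _ _ _ (dl x).
  apply: is_derive_eq.
  by rewrite /f /GRing.scale /=; field.
have ml : measurable_fun [set: R] (fun x => b * (x - m) + t).
  apply: measurable_funD => //; apply: measurable_funM => //.
  exact: measurable_funB.
have bsin x : `|sin (b * (x - m) + t)| <= 1 by exact: norm_sin_le1.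
have i1 := integrable_normal_pdfM m s (measurable_cos_comp ml)
  (fun x => norm_cos_le1 (b * (x - m) + t)).
have i2 := integrable_normal_momentM m s0 (measurable_sin_comp ml) bsin.
have j1 := integrableZl measurableT b i1.
have j2 := integrableZl measurableT (s ^- 2) i2.
have cf : continuous f.
  have cl : continuous (fun x => b * (x - m) + t).
    move=> x; apply/differentiable_continuous/derivable1_diffP.
    by apply: ex_derive; exact: dl.
  have cp := @continuous_normal_pdf R m s s0.
  move=> x; apply: cvgB.
    apply: cvgM; first exact: cvg_cst.
    apply: cvgM; first exact: cp.
    apply: (cvg_comp _ _ (cl x)); exact: continuous_cos.
  apply: cvgM; first exact: cvg_cst.
  apply: cvgM; last by apply: (cvg_comp _ _ (cl x)); exact: continuous_sin.
  apply: cvgM; first exact: cp.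
  by apply: cvgB; [exact: cvg_id|exact: cvg_cst].
have if_ : (@lebesgue_measure R).-integrable [set: R] (EFin \o f).
  rewrite /f /comp; under eq_fun do rewrite EFinB !EFinM.
  by apply: integrableB.
have F0 : F x @[x --> +oo] --> 0.
  exact: (cvg0M_bounded _ bsin (cvg_normal_pdf m s0)).
have F0' : F x @[x --> -oo] --> 0.
  exact: (cvg0M_bounded _ bsin (cvgNy_normal_pdf m s0)).
have := integrable_FTC2_line cf dF if_ F0' F0.
rewrite subr0 /f RintegralB//.
rewrite !RintegralZl// => /eqP; rewrite subr_eq0 => /eqP e.
by rewrite -mulrA e mulrA mulfV ?mul1r// expf_neq0.
Qed.

(** The derivative of y times exp (k x ^+ 2 / 2) is 0. *)
Lemma is_derive_linear_ode (R : realType) (k : R) (y : R -> R) :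
  (forall x : R, is_derive x 1 y (- (k * x) * y x)) ->
  forall x, y x = y 0 * expR (- (k * x ^+ 2 / 2)).
Proof.
move=> dy x.
have d (z : R) : is_derive z 1 (fun z => y z * expR (k * z ^+ 2 / 2)) 0.
  have de : is_derive z 1 (fun z => expR (k * z ^+ 2 / 2))
      (k * z * expR (k * z ^+ 2 / 2)).
    by apply: is_derive_eq; rewrite /GRing.scale /=; field.
  by have dz := dy z; apply: is_derive_eq; rewrite /GRing.scale /=; ring.
have := is_derive_0_is_cst x 0 d.
rewrite expr0n/= mulr0 mul0r expR0 mulr1 => <-.
by rewrite -mulrA -expRD subrr expR0 mulr1.
Qed.

(** As a function L of b, the integral can be differentiated under the integral
   sign, with dominating function density * |x - m|; [normal_Stein_sin] turns the
   result into the differential equation L' = - s ^+ 2 b L, and L 0 = cos t.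
   Centering the phase at the mean m gives one equation for L alone; with phase
   b x the sine and cosine integrals would be coupled. *)
Lemma normal_charfun_center (R : realType) (m s b t : R) : s != 0 ->
  \int[@lebesgue_measure R]_x (normal_pdf m s x * cos (b * (x - m) + t)) =
  cos t * expR (- (s ^+ 2 * b ^+ 2 / 2)).
Proof.
move=> s0.
pose f b x := normal_pdf m s x * cos (b * (x - m) + t).
pose L b := \int[@lebesgue_measure R]_x f b x.
have ml c : measurable_fun [set: R] (fun x => c * (x - m) + t).
  apply: measurable_funD => //; apply: measurable_funM => //.
  exact: measurable_funB.
have df (c x : R) : is_derive c 1 (f ^~ x)
    (- (normal_pdf m s x * (x - m) * sin (c * (x - m) + t))).
  have dl : is_derive c 1 (fun c => c * (x - m) + t) (x - m).
    by apply: is_derive_eq; rewrite /GRing.scale /=; ring.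
  have ds := @is_derive1_comp _ cos (fun c => c * (x - m) + t) c _ _ _ dl.
  apply: is_derive_eq.
  by rewrite /GRing.scale /=; ring.
have d1f c x : partial1of2 f c x =
    - (normal_pdf m s x * (x - m) * sin (c * (x - m) + t)).
  by rewrite partial1of2E; apply: derive_val; exact: df.
have Ic (c : R) : `]c - 1, c + 1[%classic c.
  by rewrite /= in_itv/=; apply/andP; split; lra.
have fint (c x : R) : `]c - 1, c + 1[%classic x ->
    (@lebesgue_measure R).-integrable [set: R] (EFin \o f x).
  move=> _; apply: (integrable_normal_pdfM m s (measurable_cos_comp (ml x))).
  by move=> y; exact: norm_cos_le1.
have fder (c x y : R) : `]c - 1, c + 1[%classic x -> [set: R] y ->
    derivable (f ^~ y) x 1.
  by move=> _ _; apply: ex_derive; exact: df.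
have G0 x : 0 <= normal_pdf m s x * `|x - m|.
  by rewrite mulr_ge0// normal_pdf_ge0.
have Gub (c x y : R) : `]c - 1, c + 1[%classic x -> [set: R] y ->
    `|partial1of2 f x y| <= normal_pdf m s y * `|y - m|.
  move=> _ _; rewrite d1f normrN !normrM (ger0_norm (normal_pdf_ge0 _ _ _)).
  by rewrite ler_piMr ?norm_sin_le1// mulr_ge0// normal_pdf_ge0.
have dL (c : R) : is_derive c 1 L (- (s ^+ 2 * c) * L c).
  have DL := @derivable_under_integral R _ _ (@lebesgue_measure R) f [set: R]
    measurableT c _ _ (Ic c) (fint c) (fder c) _ G0
    (integrable_normal_moment m s0) (Gub c).
  have EL := @differentiation_under_integral R _ _ (@lebesgue_measure R) f [set: R]
    measurableT c _ _ (Ic c) (fint c) (fder c) _ G0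
    (integrable_normal_moment m s0) (Gub c).
  apply: DeriveDef; first exact: DL.
  rewrite -derive1E EL; under eq_Rintegral do rewrite d1f -mulN1r.
  rewrite RintegralZl//; last first.
    apply: (integrable_normal_momentM m s0 (measurable_sin_comp (ml c))).
    by move=> x; exact: norm_sin_le1.
  by rewrite normal_Stein_sin// mulN1r mulNr.
rewrite -[LHS]/(L b) (is_derive_linear_ode dL); congr (_ * _).
rewrite /L /f; under eq_Rintegral do rewrite mul0r add0r mulrC.
rewrite RintegralZl//; last exact: integrable_normal_pdf.
by rewrite /Rintegral integral_normal_pdf mulr1.
Qed.

Lemma normal_charfun (R : realType) (m s b t : R) : s != 0 ->
  \int[@lebesgue_measure R]_x (normal_pdf m s x * cos (b * x + t)) =
  cos (b * m + t) * expR (- (s ^+ 2 * b ^+ 2 / 2)).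
Proof.
move=> s0; rewrite -(normal_charfun_center m)//.
by apply: eq_Rintegral => x _; congr (_ * cos _); ring.
Qed.

(** * Complex-valued integrals and product measures *)

Definition Cintegrable d (T : measurableType d) (R : realType)
    (mu : {measure set T -> \bar R}) (f : T -> R[i]) :=
  mu.-integrable [set: T] (fun x => (complex.Re (f x))%:E) /\
  mu.-integrable [set: T] (fun x => (complex.Im (f x))%:E).

Definition Cintegral d (T : measurableType d) (R : realType)
    (mu : {measure set T -> \bar R}) (f : T -> R[i]) : R[i] :=
  (\int[mu]_x complex.Re (f x)) +i* (\int[mu]_x complex.Im (f x)).

Lemma integrable_prodM d1 d2 (T1 : measurableType d1) (T2 : measurableType d2)
    (R : realType) (m1 : {sigma_finite_measure set T1 -> \bar R})
    (m2 : {sigma_finite_measure set T2 -> \bar R}) (f : T1 -> R) (g : T2 -> R) :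
  m1.-integrable [set: T1] (EFin \o f) -> m2.-integrable [set: T2] (EFin \o g) ->
  (m1 \x m2)%E.-integrable [set: T1 * T2] (fun p => (f p.1 * g p.2)%:E).
Proof.
move=> intf intg; apply/integrable12ltyP.
  apply/measurable_EFinP/measurable_funM; apply: measurableT_comp => //.
    exact/measurable_EFinP/(measurable_int _ intf).
  exact/measurable_EFinP/(measurable_int _ intg).
have ng := integrable_norm intg; have nf := integrable_norm intf.
rewrite (eq_integral (fun x => (`|f x|%:E * \int[m2]_y `|g y|%:E)%E)).
  rewrite -(fineK (integrable_fin_num measurableT ng)) integralZr//.
  by rewrite -(fineK (integrable_fin_num measurableT nf)) -EFinM ltry.
move=> x _; rewrite -integralZl//.
by apply: eq_integral => y _; rewrite /= normrM EFinM.
Qed.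

Lemma Rintegral_prodM d1 d2 (T1 : measurableType d1) (T2 : measurableType d2)
    (R : realType) (m1 : {sigma_finite_measure set T1 -> \bar R})
    (m2 : {sigma_finite_measure set T2 -> \bar R}) (f : T1 -> R) (g : T2 -> R) :
  m1.-integrable [set: T1] (EFin \o f) -> m2.-integrable [set: T2] (EFin \o g) ->
  \int[(m1 \x m2)%E]_p (f p.1 * g p.2) = (\int[m1]_x f x) * (\int[m2]_y g y).
Proof.
move=> intf intg; rewrite {1}/Rintegral -integral12_prod_meas1; last first.
  exact: integrable_prodM.
rewrite (eq_integral (fun x => (f x * \int[m2]_y g y)%:E)); last first.
  move=> x _; rewrite /fubini_F /= EFinM {1}/Rintegral fineK; last first.
    exact: integrable_fin_num.
  by rewrite -integralZl//; apply: eq_integral => y _; rewrite EFinM.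
by rewrite -RintegralZr.
Qed.

Lemma Cintegrable_prodM d1 d2 (T1 : measurableType d1) (T2 : measurableType d2)
    (R : realType) (m1 : {sigma_finite_measure set T1 -> \bar R})
    (m2 : {sigma_finite_measure set T2 -> \bar R})
    (f : T1 -> R[i]) (g : T2 -> R[i]) :
  Cintegrable m1 f -> Cintegrable m2 g ->
  Cintegrable (m1 \x m2)%E (fun p => f p.1 * g p.2).
Proof.
move=> [rf jf] [rg jg]; split.
  under eq_fun do rewrite ReM EFinB.
  by apply: integrableB => //;
    [exact: (integrable_prodM rf rg)|exact: (integrable_prodM jf jg)].
under eq_fun do rewrite ImM EFinD.
by apply: integrableD => //;
  [exact: (integrable_prodM rf jg)|exact: (integrable_prodM jf rg)].
Qed.

Lemma Cintegral_prodM d1 d2 (T1 : measurableType d1) (T2 : measurableType d2)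
    (R : realType) (m1 : {sigma_finite_measure set T1 -> \bar R})
    (m2 : {sigma_finite_measure set T2 -> \bar R})
    (f : T1 -> R[i]) (g : T2 -> R[i]) :
  Cintegrable m1 f -> Cintegrable m2 g ->
  Cintegral (m1 \x m2)%E (fun p => f p.1 * g p.2) =
  Cintegral m1 f * Cintegral m2 g.
Proof.
move=> [rf jf] [rg jg]; rewrite /Cintegral.
under eq_Rintegral do rewrite ReM.
rewrite RintegralB//;
  [|exact: (integrable_prodM rf rg)|exact: (integrable_prodM jf jg)].
under [in X in _ +i* X = _]eq_Rintegral do rewrite ImM.
rewrite RintegralD//;
  [|exact: (integrable_prodM rf jg)|exact: (integrable_prodM jf rg)].
rewrite (Rintegral_prodM rf rg) (Rintegral_prodM jf jg).
by rewrite (Rintegral_prodM rf jg) (Rintegral_prodM jf rg).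
Qed.

Lemma Cintegral_scale d (T : measurableType d) (R : realType)
    (mu : {measure set T -> \bar R}) (c : R[i]) (f : T -> R[i]) :
  Cintegrable mu f ->
  Cintegrable mu (fun x => c * f x) /\
  Cintegral mu (fun x => c * f x) = c * Cintegral mu f.
Proof.
move=> [ir ii].
have ir1 := integrableZl measurableT (complex.Re c) ir.
have ii1 := integrableZl measurableT (complex.Im c) ii.
have ir2 := integrableZl measurableT (complex.Im c) ir.
have ii2 := integrableZl measurableT (complex.Re c) ii.
split; first split.
- by under eq_fun do rewrite ReM EFinB !EFinM; exact: integrableB.
- by under eq_fun do rewrite ImM EFinD !EFinM; exact: integrableD.
rewrite /Cintegral.
under eq_Rintegral do rewrite ReM.
rewrite RintegralB//.
under [in X in _ +i* X = _]eq_Rintegral do rewrite ImM.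
rewrite RintegralD// !RintegralZl//.
by apply/eqP; rewrite eq_complex ReM ImM /= !eqxx.
Qed.

Lemma tconsK d (T : measurableType d) n :
  cancel (fun t : n.+1.-tuple T => (thead t, [tuple of behead t])) (@tcons d T n).
Proof.
move=> t; apply: val_inj.
by rewrite /= -[RHS]/(tval t) [in RHS](tuple_eta t).
Qed.

Lemma measurable_uncons d (T : measurableType d) n :
  measurable_fun [set: n.+1.-tuple T] (fun t => (thead t, [tuple of behead t])).
Proof.
by apply/measurable_fun_pairP; split;
  [exact: measurable_tnth|exact: measurable_behead].
Qed.

Lemma measurable_tcons d (T : measurableType d) n :
  measurable_fun [set: T * n.-tuple T] (@tcons d T n).
Proof.
by apply: measurable_cons; [exact: measurable_fst|exact: measurable_snd].
Qed.

Lemma measurable_fun_comp_tcons d (T : measurableType d) (R : realType) n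
    (f : n.+1.-tuple T -> \bar R) :
  measurable_fun [set: T * n.-tuple T] (f \o @tcons d T n) ->
  measurable_fun [set: n.+1.-tuple T] f.
Proof.
move=> mf; rewrite (_ : f = (f \o @tcons d T n) \o
    (fun t => (thead t, [tuple of behead t]))); last first.
  by apply/funext => t /=; rewrite tconsK.
by apply: measurableT_comp mf _; exact: measurable_uncons.
Qed.

(** [cons_measure] is the image of the product measure under [tcons], which has a
   measurable inverse. *)
Lemma integrable_cons_measure d (T : measurableType d) (R : realType)
    (m : {sigma_finite_measure set T -> \bar R}) n
    (mu : {sigma_finite_measure set (n.-tuple T) -> \bar R})
    (f : n.+1.-tuple T -> \bar R) :
  (m \x mu)%E.-integrable [set: T * n.-tuple T] (f \o @tcons d T n) ->
  (cons_measure m mu).-integrable [set: n.+1.-tuple T] f /\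
  (\int[cons_measure m mu]_t f t = \int[(m \x mu)%E]_p f (tcons p))%E.
Proof.
move=> intf; have mf := measurable_fun_comp_tcons (measurable_int _ intf).
by split; [apply: integrable_pushforward|apply: integral_pushforward] => //;
  exact: measurable_tcons.
Qed.

Lemma Cintegrable_cons_measure d (T : measurableType d) (R : realType)
    (m : {sigma_finite_measure set T -> \bar R}) n
    (mu : {sigma_finite_measure set (n.-tuple T) -> \bar R})
    (f : n.+1.-tuple T -> R[i]) :
  Cintegrable (m \x mu)%E (f \o @tcons d T n) ->
  Cintegrable (cons_measure m mu) f /\
  Cintegral (cons_measure m mu) f = Cintegral (m \x mu)%E (f \o @tcons d T n).
Proof.
pose reE := @integrable_cons_measure _ _ _ m n mu (fun x => (complex.Re (f x))%:E).
pose imE := @integrable_cons_measure _ _ _ m n mu (fun x => (complex.Im (f x))%:E).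
move=> [/reE[ir er] /imE[ii ei]].
by split=> //; rewrite /Cintegral /Rintegral er ei.
Qed.

(** Fubini on the n-fold product, by induction on n.  Integrability is part of the
   conclusion because the induction step needs it for the tail product. *)
Lemma Cintegral_tuple_prod d (T : measurableType d) (R : realType)
    (m : {sigma_finite_measure set T -> \bar R}) n (F : 'I_n -> T -> R[i]) :
  (forall i, Cintegrable m (F i)) ->
  Cintegrable (tuple_measure m n) (fun t => \prod_i F i (tnth t i)) /\
  Cintegral (tuple_measure m n) (fun t => \prod_i F i (tnth t i)) =
  \prod_i Cintegral m (F i).
Proof.
elim: n F => [|n IHn] F intF.
  rewrite big_ord0 (_ : (fun _ => _) = cst 1); last first.
    by apply/funext => t; rewrite big_ord0.
  split.
    by split; apply: finite_measure_integrable_cst.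
  rewrite /Cintegral /cst /Rintegral /= !integral_dirac//=.
  by rewrite indicE mem_set// !mul1r.
have [intG eG] := IHn (fun i => F (lift ord0 i)) (fun i => intF _).
have e : (fun t : n.+1.-tuple T => \prod_i F i (tnth t i)) \o @tcons d T n =
    (fun p => F ord0 p.1 * \prod_(i < n) F (lift ord0 i) (tnth p.2 i)).
  apply/funext => p; rewrite /= big_ord_recl; congr (_ * _).
  by apply: eq_bigr => i _; rewrite !(tnth_nth p.1).
have intP := Cintegrable_prodM (intF ord0) intG.
rewrite -e in intP.
have [iP eP] := Cintegrable_cons_measure intP.
split; first exact: iP.
by rewrite [LHS]eP e (Cintegral_prodM (intF ord0) intG) eG [RHS]big_ord_recl.
Qed.

(** * The complex exponential *)

Lemma expCD (R : realType) (x y : R[i]) : expC (x + y) = expC x * expC y.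
Proof.
case: x y => [a b] [c d]; rewrite /expC /= expRD cosD sinD.
by apply/eqP; rewrite eq_complex /=; apply/andP; split; apply/eqP; ring.
Qed.

Lemma expC0 (R : realType) : expC (0 : R[i]) = 1.
Proof. by rewrite /expC /= expR0 cos0 sin0 mul1r. Qed.

Lemma expC_sum (R : realType) I (r : seq I) (F : I -> R[i]) :
  expC (\sum_(i <- r) F i) = \prod_(i <- r) expC (F i).
Proof. exact: (big_morph _ (@expCD R) (@expC0 R)). Qed.

Lemma expC_conj (R : realType) (x : R[i]) : expC (x^*)%C = ((expC x)^*)%C.
Proof.
case: x => [a b]; rewrite /expC /= cosN sinN.
by apply/eqP; rewrite eq_complex /=; apply/andP; split; apply/eqP; ring.
Qed.

Lemma Re_expC (R : realType) (x : R[i]) :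
  complex.Re (expC x) = expR (complex.Re x) * cos (complex.Im x).
Proof. by rewrite /expC ReM /= mul0r subr0. Qed.

Lemma Im_expC (R : realType) (x : R[i]) :
  complex.Im (expC x) = expR (complex.Re x) * sin (complex.Im x).
Proof. by rewrite /expC ImM /= mul0r addr0. Qed.

Lemma normc_expC (R : realType) (x : R[i]) : `|expC x| = (expR (complex.Re x))%:C.
Proof.
rewrite normc_def Re_expC Im_expC !exprMn -mulrDr cos2Dsin2 mulr1.
by rewrite sqrtr_sqr ger0_norm// expR_ge0.
Qed.

Lemma expC_real (R : realType) (x : R) : expC x%:C = (expR x)%:C.
Proof. by rewrite /expC /= cos0 sin0 mulr1. Qed.

(** The derivative in the form in which the remainders of exp, cos and sin can be
   combined in [expC_le]. *)
Lemma derive0_le (R : realType) (f : R -> R) (a : R) :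
  is_derive (0 : R) (1 : R) f a -> forall e : R, 0 < e ->
  \forall x \near (0 : R), `|f x - f 0 - a * x| <= e * `|x|.
Proof.
move=> [/cvg_ex[/= l fl] dfa] e e0.
have la : l = a by rewrite -dfa; exact/esym/cvg_lim.
rewrite la in fl => {la dfa}.
move/cvgrPdist_le : fl => /(_ _ e0); rewrite near_withinE; apply: filterS => x.
have [->|x0] := eqVneq x 0; first by rewrite subrr mulr0 subrr normr0 mulr0.
move=> /(_ isT); rewrite addr0 {1}/GRing.scale /= /GRing.scale /= mulr1 => h.
rewrite (_ : _ - _ = - ((a - x^-1 * (f x - f 0)) * x)); last by field.
by rewrite normrN normrM ler_wpM2r.
Qed.

Lemma near_Re_Im (R : realType) (P : R -> Prop) :
  (\forall x \near (0 : R), P x) ->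
  \forall h \near (0 : R[i]^o), P (complex.Re h) /\ P (complex.Im h).
Proof.
move=> /nbhs_ballP[d /= d0 dP]; apply/nbhs_ballP; exists d%:C => /=.
  by rewrite ltcR.
move=> [x y]; rewrite /ball /= sub0r normrN normc_def ltcR /= => xyd.
have le_sqrt (u v : R) : `|u| <= Num.sqrt (u ^+ 2 + v ^+ 2).
  by rewrite -sqrtr_sqr ler_wsqrtr// lerDl sqr_ge0.
split; apply: dP; rewrite /ball /= sub0r normrN.
  exact: le_lt_trans xyd.
by rewrite addrC in xyd; exact: le_lt_trans xyd.
Qed.

(** The complex derivative of expC at 0.  It is obtained from the derivatives at 0
   of the three real functions that define expC. *)
Lemma expC_le (R : realType) (e : R) : 0 < e ->
  \forall h \near (0 : R[i]^o), `|expC h - 1 - h| <= e%:C * `|h|.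
Proof.
move=> e0; pose k := e / 7.
have k0 : 0 < k by rewrite divr_gt0.
have := derive0_le (@is_derive_expR R 0) k0; rewrite expR0 => nexp.
have := derive0_le (@is_derive_cos R 0) k0; rewrite cos0 sin0 oppr0 => ncos.
have := derive0_le (@is_derive_sin R 0) k0; rewrite cos0 sin0 => nsin.
have nk : \forall x \near (0 : R), `|x| <= k by exact: nbhs0_le.
have n1 : \forall x \near (0 : R), `|x| <= 1 by exact: nbhs0_le.
have nP : \forall x \near (0 : R), [/\ `|expR x - 1 - 1 * x| <= k * `|x|,
    `|cos x - 1 - 0 * x| <= k * `|x|, `|sin x - 0 - 1 * x| <= k * `|x|,
    `|x| <= k & `|x| <= 1].
  by near=> x; split; near: x.
have := near_Re_Im nP; apply: filterS => -[x y] /= [[hx _ _ xk x1] [_ hy hsy _ _]].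
rewrite mul1r in hx; rewrite mul0r subr0 in hy; rewrite subr0 mul1r in hsy.
set r := Num.sqrt (x ^+ 2 + y ^+ 2).
have hr : `|x +i* y| = r%:C by rewrite normc_def.
have xr : `|x| <= r by rewrite -sqrtr_sqr ler_wsqrtr// lerDl sqr_ge0.
have yr : `|y| <= r by rewrite -sqrtr_sqr ler_wsqrtr// lerDr sqr_ge0.
rewrite hr -rmorphM /= normc_def lecR.
have norm_le (u v : R) : Num.sqrt (u ^+ 2 + v ^+ 2) <= `|u| + `|v|.
  rewrite -[leRHS]ger0_norm ?addr_ge0// -sqrtr_sqr ler_wsqrtr//.
  rewrite sqrrD !real_normK ?num_real// addrAC lerDl.
  by rewrite mulrn_wge0// mulr_ge0.
apply: le_trans (norm_le _ _) _.
rewrite !ReB !ImB Re_expC Im_expC /=.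
(* Both parts of exp h - 1 - h are rearranged so that every summand contains
   one of the three real first-order remainders, or the product x * y. *)
rewrite (_ : _ - 1 - x =
  (expR x - 1 - x) * cos y + (1 + x) * (cos y - 1)); last by ring.
rewrite (_ : _ - 0 - y =
  (expR x - 1 - x) * sin y + (1 + x) * (sin y - y) + x * y); last by ring.
have c1 := norm_cos_le1 y.
have s1 := norm_sin_le1 y.
have x2 : `|1 + x| <= 2.
  by apply: le_trans (ler_normD _ _) _; rewrite normr1 -[2]/(1 + 1) lerD2l.
have A : `|(expR x - 1 - x) * cos y| <= k * r.
  rewrite normrM -[leRHS]mulr1 ler_pM//; apply: le_trans hx _.
  by rewrite ler_wpM2l// ltW.
have B : `|(expR x - 1 - x) * sin y| <= k * r.
  rewrite normrM -[leRHS]mulr1 ler_pM//; apply: le_trans hx _.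
  by rewrite ler_wpM2l// ltW.
have C : `|(1 + x) * (cos y - 1)| <= 2 * (k * r).
  rewrite normrM ler_pM//; apply: le_trans hy _.
  by rewrite ler_wpM2l// ltW.
have D : `|(1 + x) * (sin y - y)| <= 2 * (k * r).
  rewrite normrM ler_pM//; apply: le_trans hsy _.
  by rewrite ler_wpM2l// ltW.
have E : `|x * y| <= k * r by rewrite normrM ler_pM.
(* 7 = 1 + 2 + 1 + 2 + 1, the sum of the constants in the five bounds above *)
have -> : e * r = 7 * (k * r) by rewrite /k; field.
have F := ler_normD ((expR x - 1 - x) * cos y) ((1 + x) * (cos y - 1)).
have G := ler_normD ((expR x - 1 - x) * sin y + (1 + x) * (sin y - y)) (x * y).
have H := ler_normD ((expR x - 1 - x) * sin y) ((1 + x) * (sin y - y)).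
lra.
Unshelve. all: by end_near. Qed.

(** By expC (h + z) = expC h * expC z the derivative at z reduces to the one at 0. *)
Lemma derivable_expC (R : realType) (z : R[i]) :
  derivable (expC : R[i]^o -> R[i]^o) z 1.
Proof.
apply/cvg_ex; exists (expC z); apply/cvgrPdist_le => /= e e0.
have [d eE] : exists d : R, e = d%:C.
  by case: e e0 => a b; rewrite ltcE /= => /andP[/eqP -> _]; exists a.
rewrite eE ltcR in e0; rewrite eE.
rewrite near_withinE.
have k0 : 0 < d / expR (complex.Re z) by rewrite divr_gt0// expR_gt0.
have := expC_le k0; apply: filterS => h hle h0.
rewrite (_ : h *: 1 = h); last by rewrite /GRing.scale /= mulr1.
rewrite expCD (_ : _ - _ = - (expC z * (expC h - 1 - h) / h)); last first.
  by rewrite /GRing.scale /=; field.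
rewrite normrN normrM normfV normrM normc_expC ler_pdivrMr ?normr_gt0//.
rewrite -[leRHS](mulVKf (x := (expR (complex.Re z))%:C)); last first.
  by rewrite eq_complex /= eqxx andbT gt_eqF// expR_gt0.
rewrite ler_wpM2l ?ler0c ?expR_ge0//; apply: le_trans hle _.
by rewrite rmorphM /= fmorphV mulrA [_^-1 * _]mulrC.
Qed.

Lemma differentiable_expC_cdot (R : realType) n (c a : R[i]) (u : 'cV[R[i]]_n) :
  forall z, differentiable
    ((fun z => c * expC (a * cdot z u)) : 'cV[R[i]]_n -> R[i]^o) z.
Proof.
move=> z; apply: differentiableM; first exact: differentiable_cst.
apply: (@differentiable_comp _ _ R[i]^o R[i]^o (fun z => a * cdot z u) expC).
  apply: differentiableM; first exact: differentiable_cst.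
  rewrite /cdot.
  have -> : (fun z : 'cV[R[i]]_n => \sum_i z i 0 * ((u i 0)^*)%C) =
    \sum_i (fun z : 'cV[R[i]]_n => z i 0 * ((u i 0)^*)%C : R[i]^o).
    by apply/funext => y; rewrite fct_sumE.
  apply: differentiable_sum => i.
  apply: differentiableM; last exact: differentiable_cst.
  exact: differentiable_coord.
apply/derivable1_diffP.
exact: derivable_expC.
Qed.

(** * One-dimensional Gaussian integrals *)

(** The normalising factor makes the integral equal to 1 for c = 0, so that a
   product of 2n such functions carries exactly the constant (alpha / pi) ^+ n of
   the Gaussian measure on C^n. *)
Definition gauss_exp (R : realType) (alpha : R) (c : R[i]) (x : R) : R[i] :=
  (Num.sqrt (alpha / pi))%:C * expC (c * x%:C - (alpha * x ^+ 2)%:C).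

Lemma normal_charfun_sin (R : realType) (m s b : R) : s != 0 ->
  \int[@lebesgue_measure R]_x (normal_pdf m s x * sin (b * x)) =
  sin (b * m) * expR (- (s ^+ 2 * b ^+ 2 / 2)).
Proof.
move=> s0.
have sinE x : sin x = cos (x + - (pi / 2)) :> R.
  by rewrite cosD cosN sinN cos_pihalf sin_pihalf; ring.
by under eq_Rintegral do rewrite sinE; rewrite normal_charfun// -sinE.
Qed.

(** Completing the square in the real part of the exponent leaves a normal density
   with variance 1 / (2 alpha); the imaginary part of c is the frequency. *)
Lemma gauss_exp_normal (R : realType) (alpha : R) (c : R[i]) (x : R) : 0 < alpha ->
  let a := complex.Re c in let b := complex.Im c in
  let N := normal_pdf (a / (2 * alpha)) (Num.sqrt (2 * alpha))^-1 x in
  let k := expR (a ^+ 2 / (4 * alpha)) in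
  complex.Re (gauss_exp alpha c x) = k * (N * cos (b * x)) /\
  complex.Im (gauss_exp alpha c x) = k * (N * sin (b * x)).
Proof.
move=> a0 a b N k.
have s2 : (Num.sqrt (2 * alpha))^-1 ^+ 2 = (2 * alpha)^-1.
  by rewrite exprVn sqr_sqrtr// mulr_ge0// ltW.
have h : Num.sqrt (alpha / pi) * expR (a * x - alpha * x ^+ 2) = k * N.
  rewrite /N normal_pdfE; last by rewrite invr_neq0// gt_eqF// sqrtr_gt0 mulr_gt0.
  rewrite /normal_peak /normal_fun s2 /k [RHS]mulrCA -expRD -sqrtrV; last first.
    by rewrite pmulrn_lge0// mulr_ge0 ?pi_ge0// invr_ge0 mulr_ge0// ltW.
  have p0 : pi != 0 :> R by rewrite gt_eqF// pi_gt0.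
  have a1 : alpha != 0 by rewrite gt_eqF.
  congr (Num.sqrt _ * expR _).
    by rewrite -mulr_natr; move: (pi : R) p0 => q q0; field; rewrite a1 q0.
  by rewrite -mulr_natr; field.
have e1 : complex.Re (c * x%:C - (alpha * x ^+ 2)%:C) = a * x - alpha * x ^+ 2.
  by rewrite ReB ReM /= mulr0 subr0.
have e2 : complex.Im (c * x%:C - (alpha * x ^+ 2)%:C) = b * x.
  by rewrite ImB ImM /= mulr0 add0r subr0.
split.
  by rewrite /gauss_exp ReM Re_expC e1 e2 /= mul0r subr0 mulrA h -mulrA.
by rewrite /gauss_exp ImM Im_expC e1 e2 /= mul0r addr0 mulrA h -mulrA.
Qed.

(** The Gaussian integral of exp (c x) for complex c.  The real part of c moves the
   mean of the normal density, the imaginary part enters through the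
   characteristic function. *)
Lemma Cintegral_gauss_exp (R : realType) (alpha : R) (c : R[i]) : 0 < alpha ->
  Cintegrable (@lebesgue_measure R) (gauss_exp alpha c) /\
  Cintegral (@lebesgue_measure R) (gauss_exp alpha c) =
  expC (c ^+ 2 / (4 * alpha)%:C).
Proof.
move=> a0.
have s0 : (Num.sqrt (2 * alpha))^-1 != 0.
  by rewrite invr_neq0// gt_eqF// sqrtr_gt0 mulr_gt0.
have s2 : (Num.sqrt (2 * alpha))^-1 ^+ 2 = (2 * alpha)^-1.
  by rewrite exprVn sqr_sqrtr// mulr_ge0// ltW.
pose m := complex.Re c / (2 * alpha); pose s := (Num.sqrt (2 * alpha))^-1.
pose k := expR (complex.Re c ^+ 2 / (4 * alpha)).
have ml : measurable_fun [set: R] (fun x => complex.Im c * x).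
  exact: measurable_funM.
have icos : (@lebesgue_measure R).-integrable [set: R]
    (EFin \o (fun x => normal_pdf m s x * cos (complex.Im c * x))).
  apply: (integrable_normal_pdfM m s (measurable_cos_comp ml)) => x.
  exact: norm_cos_le1.
have isin : (@lebesgue_measure R).-integrable [set: R]
    (EFin \o (fun x => normal_pdf m s x * sin (complex.Im c * x))).
  apply: (integrable_normal_pdfM m s (measurable_sin_comp ml)) => x.
  exact: norm_sin_le1.
have Er x := (gauss_exp_normal c x a0).1.
have Ei x := (gauss_exp_normal c x a0).2.
split.
  split; [under eq_fun do rewrite Er EFinM|under eq_fun do rewrite Ei EFinM].
    exact: integrableZl.
  exact: integrableZl.
rewrite /Cintegral; under eq_Rintegral do rewrite Er.
under [in X in _ +i* X = _]eq_Rintegral do rewrite Ei.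
rewrite !RintegralZl//.
have := normal_charfun m (complex.Im c) 0 s0; under eq_Rintegral do rewrite addr0.
move=> ->; rewrite normal_charfun_sin// s2 addr0.
have cE : c ^+ 2 / (4 * alpha)%:C =
    ((complex.Re c ^+ 2 - complex.Im c ^+ 2) / (4 * alpha)) +i*
    (complex.Im c * m).
  rewrite /m -fmorphV; case: c {m k ml icos isin Er Ei} => a b.
  apply/eqP; rewrite eq_complex expr2 ReM ImM /=.
  by apply/andP; split; apply/eqP; field; rewrite gt_eqF.
have kE : k * expR (- ((2 * alpha)^-1 * complex.Im c ^+ 2 / 2)) =
   expR ((complex.Re c ^+ 2 - complex.Im c ^+ 2) / (4 * alpha)).
  by rewrite -expRD; congr expR; field; rewrite gt_eqF.
apply/eqP; rewrite eq_complex Re_expC Im_expC cE /= -!kE.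
by apply/andP; split; apply/eqP; rewrite /k; ring.
Qed.

(** * Gaussian integrals on C^n *)

Lemma gauss_integralE (R : realType) (alpha : R) n (g : 'cV[R[i]]_n -> R[i]) :
  gauss_integral alpha g = Cintegral (volume n)
    (fun t => g (of_real_coords t) * (gauss_density alpha (of_real_coords t))%:C).
Proof.
by rewrite /gauss_integral /Cintegral; congr (_ +i* _); apply: eq_Rintegral => t _;
  rewrite ?ReM ?ImM /= mulr0 ?subr0 ?add0r.
Qed.

Lemma cdot_self (R : realType) n (z : 'cV[R[i]]_n) :
  cdot z z = (sqnorm z)%:C.
Proof.
apply/eqP; rewrite eq_complex /sqnorm eqxx /= /cdot.
rewrite (big_morph _ (@ImD R) (erefl : complex.Im (0 : R[i]) = 0)) big1// => i _.
by rewrite mulc_conj.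
Qed.

Lemma sqnormE (R : realType) n (z : 'cV[R[i]]_n) :
  sqnorm z = \sum_i (complex.Re (z i 0) ^+ 2 + complex.Im (z i 0) ^+ 2).
Proof.
rewrite /sqnorm /cdot (big_morph _ (@ReD R) (erefl : complex.Re (0 : R[i]) = 0)).
by apply: eq_bigr => i _; rewrite mulc_conj.
Qed.

Lemma sqnorm_ge0 (R : realType) n (z : 'cV[R[i]]_n) : 0 <= sqnorm z.
Proof. by rewrite sqnormE sumr_ge0// => i _; rewrite addr_ge0 ?sqr_ge0. Qed.

(** For z = x + iy, the exponent alpha (z conj u + conj z v) is linear in the real
   coordinates, with coefficient alpha (conj u + v) at x and alpha i (conj u - v)
   at y. *)
Definition linear_coef (R : realType) (alpha : R) n (u v : 'cV[R[i]]_n)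
    (k : 'I_(n + n)) : R[i] :=
  match fintype.split k with
  | inl j => alpha%:C * ((u j 0)^*%C + v j 0)
  | inr j => alpha%:C * 'i%C * ((u j 0)^*%C - v j 0)
  end.

Lemma split_lshift m n (i : 'I_m) : fintype.split (lshift n i) = inl i.
Proof. by have := unsplitK (inl i : 'I_m + 'I_n). Qed.

Lemma split_rshift m n (i : 'I_n) : fintype.split (rshift m i) = inr i.
Proof. by have := unsplitK (inr i : 'I_m + 'I_n). Qed.

(** The product of an exponential, a conjugate exponential and the Gaussian density
   splits over the 2n real coordinates, which makes Fubini applicable. *)
Lemma fock_integrand_prod (R : realType) (alpha : R) n (u v : 'cV[R[i]]_n)
    (t : (n + n).-tuple (measurableTypeR R)) : 0 < alpha ->
  let z := of_real_coords t in
  expC (alpha%:C * cdot z u) * (expC (alpha%:C * cdot z v))^*%C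
    * (gauss_density alpha z)%:C =
  \prod_k gauss_exp alpha (linear_coef alpha u v k) (tnth t k).
Proof.
move=> a0 z.
have wE : (Num.sqrt (alpha / pi))%:C ^+ (n + n) = ((alpha / pi) ^+ n)%:C :> R[i].
  rewrite -rmorphXn addnn -mul2n exprM sqr_sqrtr//.
  by rewrite divr_ge0 ?pi_ge0// ltW.
have dE : (gauss_density alpha z)%:C =
    ((alpha / pi) ^+ n)%:C * expC (- alpha * sqnorm z)%:C.
  by rewrite expC_real -rmorphM.
rewrite -expC_conj -expCD dE mulrCA -expCD.
rewrite /gauss_exp big_split prodr_const card_ord wE -expC_sum.
congr (_ * expC _).
have cD (x y : R[i]) : ((x + y)^*)%C = (x^*)%C + (y^*)%C by exact: rmorphD.
have rM (x y : R) : (x * y)%:C = x%:C * y%:C :> R[i] by exact: rmorphM.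
have rD (x y : R) : (x + y)%:C = x%:C + y%:C :> R[i] by exact: rmorphD.
have rN (x : R) : (- x)%:C = - x%:C :> R[i] by exact: rmorphN.
rewrite sqnormE /cdot conjcM conjc_real rM rN (big_morph _ cD (conjc0 R)).
rewrite (big_morph _ rD (erefl : (0 : R)%:C = 0)) !mulr_sumr -!big_split.
rewrite big_split_ord /= -big_split /=; apply: eq_bigr => j _.
rewrite /linear_coef split_lshift split_rshift !conjcM conjcK.
rewrite /z /of_real_coords !mxE.
set x := tnth t (lshift n j); set y := tnth t (rshift n j).
have zE : (x +i* y)%C = x%:C + 'i%C * y%:C by rewrite [LHS]complexE.
have zJ : (x +i* y)^*%C = x%:C - 'i%C * y%:C.
  by rewrite zE cD conjcM !conjc_real; congr (_ + _); simpc.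
rewrite zJ /= zE rD !rM; ring.
Qed.

(** In each complex coordinate (conj u + v) ^+ 2 - (conj u - v) ^+ 2 = 4 conj u v;
   the minus sign is the square of i. *)
Lemma linear_coef_sqr (R : realType) (alpha : R) n (u v : 'cV[R[i]]_n) : 0 < alpha ->
  \sum_k linear_coef alpha u v k ^+ 2 / (4 * alpha)%:C = alpha%:C * cdot v u.
Proof.
move=> a0; rewrite big_split_ord /= -big_split /= /cdot mulr_sumr.
apply: eq_bigr => j _; rewrite /linear_coef split_lshift split_rshift !exprMn sqr_i.
have a1 : alpha%:C != 0 :> R[i] by rewrite eq_complex /= eqxx andbT gt_eqF.
by rewrite rmorphM rmorph_nat /=; field; rewrite a1.
Qed.

(** The reproducing property, on exponentials: the inner product of the kernels at u
   and v is the kernel at u evaluated at v. *)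
Lemma Cintegral_fock_integrand (R : realType) (alpha : R) n (u v : 'cV[R[i]]_n) :
  0 < alpha ->
  let F t := let z := of_real_coords t in
    expC (alpha%:C * cdot z u) * (expC (alpha%:C * cdot z v))^*%C
    * (gauss_density alpha z)%:C in
  Cintegrable (volume n) F /\ Cintegral (volume n) F = expC (alpha%:C * cdot v u).
Proof.
move=> a0 F.
have -> : F =
    (fun t => \prod_k gauss_exp alpha (linear_coef alpha u v k) (tnth t k)).
  by apply/funext => t; exact: fock_integrand_prod.
have [I E] := @Cintegral_tuple_prod _ _ _ (@lebesgue_measure R) _
  (fun k => gauss_exp alpha (linear_coef alpha u v k))
  (fun k => (Cintegral_gauss_exp _ a0).1).
split; first exact: I.
rewrite [LHS]E -linear_coef_sqr// expC_sum; apply: eq_bigr => k _.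
exact: (Cintegral_gauss_exp _ a0).2.
Qed.

(** * Exponentials in the Fock space *)

(** The squared norm is |c|^2 times the case v = u of [Cintegral_fock_integrand].
   The family of all multiples of exponentials contains the kernels, the normalized
   kernels and their compositions with a scalar map. *)
Lemma mem_fock_space_exp (R : realType) (alpha : R) n (c : R[i]) (u : 'cV[R[i]]_n) :
  0 < alpha ->
  (fun z => c * expC (alpha%:C * cdot z u)) \in fock_space (n := n) alpha.
Proof.
move=> a0; rewrite inE; split; first exact: differentiable_expC_cdot.
have [I _] := Cintegral_fock_integrand u u a0.
have [[J _] _] := Cintegral_scale (c * c^*%C) I.
apply: le_lt_trans (integrable_lty measurableT J).
rewrite le_eqVlt; apply/orP; left; apply/eqP; apply: eq_integral => t _.
set z := of_real_coords t; set E := expC _; congr (_%:E).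
have h (x : R[i]) : (complex.Re `|x|) ^+ 2 = complex.Re (x * x^*%C).
  by rewrite mulc_conj normc_def /= sqr_sqrtr// addr_ge0 ?sqr_ge0.
have -> : c * c^*%C * (E * E^*%C * (gauss_density alpha z)%:C) =
    (c * E) * (c * E)^*%C * (gauss_density alpha z)%:C.
  by rewrite (conjcM c E); ring.
by rewrite h [RHS]ReM /= mulr0 subr0.
Qed.

Lemma val_to_fock_exp (R : realType) (alpha : R) n (c : R[i]) (u : 'cV[R[i]]_n) :
  0 < alpha ->
  val (to_fock alpha (fun z => c * expC (alpha%:C * cdot z u))) =
  (fun z => c * expC (alpha%:C * cdot z u)).
Proof. by move=> a0; rewrite insubdK//; exact: mem_fock_space_exp. Qed.

Lemma fock_inner_exp (R : realType) (alpha : R) n (f g : fock_space (n := n) alpha)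
    (c d : R[i]) (u v : 'cV[R[i]]_n) : 0 < alpha ->
  val f = (fun z => c * expC (alpha%:C * cdot z u)) ->
  val g = (fun z => d * expC (alpha%:C * cdot z v)) ->
  fock_inner f g = c * d^*%C * expC (alpha%:C * cdot v u).
Proof.
move=> a0 fE gE; rewrite /fock_inner gauss_integralE fE gE.
have [I e] := Cintegral_fock_integrand u v a0.
rewrite -e -(Cintegral_scale _ I).2; congr Cintegral.
by apply/funext => t; cbv beta zeta; rewrite conjCE (conjcM d); ring.
Qed.

Lemma val_fock_kernel (R : realType) (alpha : R) n (w : 'cV[R[i]]_n) : 0 < alpha ->
  val (fock_kernel alpha w) = (fun z => expC (alpha%:C * cdot z w)).
Proof.
move=> a0; rewrite /fock_kernel.
have -> : (fun z => expC (alpha%:C * cdot z w)) =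
    (fun z => 1 * expC (alpha%:C * cdot z w)).
  by apply/funext => z; rewrite mul1r.
exact: val_to_fock_exp.
Qed.

Lemma fock_norm_kernel (R : realType) (alpha : R) n (w : 'cV[R[i]]_n) : 0 < alpha ->
  fock_norm (fock_kernel alpha w) = Num.sqrt (expR (alpha * sqnorm w)).
Proof.
move=> a0; rewrite /fock_norm (@fock_inner_exp _ _ _ _ _ 1 1 w w)//.
- by rewrite conjc1 !mul1r cdot_self -rmorphM expC_real.
- by rewrite val_fock_kernel//; apply/funext => z; rewrite mul1r.
- by rewrite val_fock_kernel//; apply/funext => z; rewrite mul1r.
Qed.

Lemma val_normalized_kernel (R : realType) (alpha : R) n (w : 'cV[R[i]]_n) :
  0 < alpha ->
  val (normalized_kernel alpha w) =
  (fun z => (Num.sqrt (expR (alpha * sqnorm w)))^-1%:C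
            * expC (alpha%:C * cdot z w)).
Proof.
move=> a0; rewrite /normalized_kernel fock_norm_kernel//.
rewrite -val_to_fock_exp//; congr (val (to_fock _ _)).
by apply/funext => z; rewrite val_fock_kernel// fmorphV mulrC.
Qed.

(** * The Berezin range of a scalar composition operator *)

(** A scalar map on the argument of an exponential moves to its parameter, so
   composition with it maps a multiple of an exponential to another one. *)
Lemma cdot_scale_l (R : realType) n (a : R[i]) (z w : 'cV[R[i]]_n) :
  cdot (a%:M *m z) w = cdot z (a^*%C *: w).
Proof.
rewrite mul_scalar_mx; apply: eq_bigr => i _.
by rewrite !mxE !conjCE conjcM conjcK; ring.
Qed.

Lemma cdot_scale_r (R : realType) n (a : R[i]) (z w : 'cV[R[i]]_n) :
  cdot z (a^*%C *: w) = a * cdot z w.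
Proof.
rewrite /cdot mulr_sumr; apply: eq_bigr => i _.
by rewrite !mxE !conjCE conjcM conjcK; ring.
Qed.

(** The inner product of k_(conj lambda w) and k_w is exp (alpha lambda |w|^2);
   normalization divides it by exp (alpha |w|^2). *)
Lemma berezin_scalar (R : realType) (alpha : R) n (lambda : R[i])
    (w : 'cV[R[i]]_n) :
  0 < alpha ->
  fock_inner (composition_operator (alpha := alpha)
       (fun z : 'cV[R[i]]_n => lambda%:M *m z) (normalized_kernel alpha w))
    (normalized_kernel alpha w) =
  expC ((alpha * sqnorm w)%:C * (lambda - 1)).
Proof.
move=> a0; have e0 : 0 < expR (alpha * sqnorm w) by exact: expR_gt0.
rewrite (@fock_inner_exp _ _ _ _ _
  (Num.sqrt (expR (alpha * sqnorm w)))^-1%:C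
  (Num.sqrt (expR (alpha * sqnorm w)))^-1%:C
  (lambda^*%C *: w) w a0 _ (val_normalized_kernel w a0)); last first.
  rewrite /composition_operator -val_to_fock_exp//; congr (val (to_fock _ _)).
  by apply/funext => z; rewrite /= val_normalized_kernel// cdot_scale_l.
have normE : (Num.sqrt (expR (alpha * sqnorm w)))^-1%:C *
    (Num.sqrt (expR (alpha * sqnorm w)))^-1%:C =
    expC (- (alpha * sqnorm w))%:C :> R[i].
  rewrite expC_real expRN -[LHS]rmorphM; congr (_%:C).
  by rewrite -invfM -expr2 sqr_sqrtr// ltW.
rewrite conjc_real normE -expCD cdot_scale_r cdot_self; congr expC.
by rewrite rmorphN rmorphM /=; ring.
Qed.

Lemma sqnorm_surj (R : realType) n (r : R) : (0 < n)%N -> 0 <= r ->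
  exists w : 'cV[R[i]]_n, sqnorm w = r.
Proof.
case: n => // n _ r0; exists (\col_j (if j == ord0 then (Num.sqrt r)%:C else 0)).
rewrite sqnormE big_ord_recl big1 => [|i _]; rewrite !mxE /= expr0n ?addr0//.
by rewrite sqr_sqrtr// addr0.
Qed.

(** In positive dimension |w|^2 takes every nonnegative value, so alpha |w|^2 does
   as well. *)
Lemma berezin_range_scalar (R : realType) (alpha : R) n (lambda : R[i]) :
  0 < alpha -> (0 < n)%N ->
  berezin_range (composition_operator (alpha := alpha)
       (fun z : 'cV[R[i]]_n => lambda%:M *m z)) =
  [set expC (r%:C * (lambda - 1)) | r in [set r : R | 0 <= r]].
Proof.
move=> a0 n0; apply/seteqP; split => [_ [w _ <-]|_ [r /= r0 <-]].
  rewrite berezin_scalar//; exists (alpha * sqnorm w) => //=.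
  by rewrite mulr_ge0 ?sqnorm_ge0// ltW.
have [|w wr] := @sqnorm_surj R n (r / alpha) n0; first by rewrite divr_ge0// ltW.
by exists w => //; rewrite berezin_scalar// wr [alpha * _]mulrC divfK// gt_eqF//.
Qed.

(** * Convexity of the curve *)

Lemma convex_combination_itv01 (R : realFieldType) (k x y : R) :
  0 <= k -> k <= 1 -> 0 < x <= 1 -> 0 < y <= 1 ->
  0 < k * x + (1 - k) * y <= 1.
Proof.
move=> k0 k1 /andP[x0 x1] /andP[y0 y1]; have k1' : 0 <= 1 - k by rewrite subr_ge0.
apply/andP; split; last first.
  rewrite [leRHS](_ : 1 = k * 1 + (1 - k) * 1); last by ring.
  by rewrite lerD// ler_wpM2l.
have [->|kn0] := eqVneq k 0; first by rewrite mul0r add0r subr0 mul1r.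
have kx : 0 < k * x by rewrite mulr_gt0// lt0r kn0.
by rewrite ltr_wpDr// mulr_ge0// ltW.
Qed.

(** The set is ]0, 1] for t < 1, and {1} for t = 1. *)
Lemma convex_exp_real_ray (R : realType) (t : R) : t <= 1 ->
  convex_set (M := Rcomplex R)
    [set expC (r%:C * (t%:C - 1)) | r in [set r : R | 0 <= r]].
Proof.
move=> t1.
have expE (r : R) : expC (r%:C * (t%:C - 1)) = (expR (r * (t - 1)))%:C.
  by rewrite -expC_real rmorphM rmorphB.
move=> _ _ k /set_mem[r /= r0 <-] /set_mem[q /= q0 <-].
apply/mem_set; rewrite !expE.
set x := expR (r * (t - 1)); set y := expR (q * (t - 1)).
have x0 : 0 < x by exact: expR_gt0.
have y0 : 0 < y by exact: expR_gt0.
have expR_le1 (p : R) : 0 <= p -> expR (p * (t - 1)) <= 1.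
  by move=> p0; rewrite -[leRHS]expR0 ler_expR mulr_ge0_le0 ?subr_le0.
have xy : conv k (x%:C : convex_lmodType (Rcomplex R)) y%:C =
    (k%:num * x + (1 - k%:num) * y)%:C.
  by apply/eqP; rewrite eq_complex /= !mulr0 addr0 !eqxx.
pose v := k%:num * x + (1 - k%:num) * y; rewrite xy -/v.
have v01 : 0 < v <= 1.
  have k0 : 0 <= k%:num by [].
  have k1 : k%:num <= 1 by [].
  have hx : 0 < x <= 1 by rewrite x0 expR_le1.
  have hy : 0 < y <= 1 by rewrite y0 expR_le1.
  exact: convex_combination_itv01.
have [v0 v1] := andP v01.
have [tE|t_neq1] := eqVneq t 1.
  (* here x = y = 1 *)
  exists 0 => //=; rewrite expE mul0r expR0 /v /x /y tE subrr !mulr0 expR0.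
  by congr (_%:C); ring.
have tlt : t - 1 < 0 by rewrite subr_lt0 lt_neqAle t_neq1.
exists (ln v / (t - 1)) => /=.
  by apply: mulr_le0; [exact: ln_le0|rewrite invr_le0 ltW].
by rewrite expE divfK ?lnK// lt_eqF.
Qed.

(** At r = pi / |Im lambda| the spiral crosses the negative real axis, in some
   point - p, and it starts at 1; the segment from 1 to - p contains 0, but no
   exponential vanishes. *)
Lemma nonconvex_spiral (R : realType) (lambda : R[i]) : complex.Im lambda != 0 ->
  ~ convex_set (M := Rcomplex R)
    [set expC (r%:C * (lambda - 1)) | r in [set r : R | 0 <= r]].
Proof.
case: lambda => a b /= b0 cvx.
pose p := expR (pi / `|b| * (a - 1)).
have p0 : 0 < p by exact: expR_gt0.
have in1 : [set expC (r%:C * (a +i* b - 1)) | r in [set r : R | 0 <= r]] 1.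
  by exists 0 => //=; rewrite mul0r expC0.
have inp : [set expC (r%:C * (a +i* b - 1)) | r in [set r : R | 0 <= r]] (- p)%:C.
  exists (pi / `|b|) => /=; first by rewrite divr_ge0// pi_ge0.
  apply/eqP; rewrite eq_complex Re_expC Im_expC ReM ImM ReB ImB /=.
  rewrite !mul0r !subr0 !addr0.
  have cs : cos (pi / `|b| * b) = -1 /\ sin (pi / `|b| * b) = 0.
    have [bp|bn|bE] := ltrgtP b 0.
    - by rewrite ltr0_norm// invrN mulrN mulNr divfK// cosN sinN cospi sinpi oppr0.
    - by rewrite gtr0_norm// divfK// cospi sinpi.
    - by rewrite bE eqxx in b0.
  by rewrite cs.1 cs.2 mulr0 mulrN1 !eqxx.
(* the weight of 1 in the combination of 1 and - p that equals 0 *)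
have k0 : 0 <= p / (1 + p) by rewrite divr_ge0 ?addr_ge0 ?ltW.
have k1 : p / (1 + p) <= 1 by rewrite ler_pdivrMr ?addr_gt0// mul1r lerDr.
have /set_mem[r _] := cvx 1 (- p)%:C (Itv01 k0 k1) (mem_set in1) (mem_set inp).
have -> : conv (Itv01 k0 k1) (1%:C : convex_lmodType (Rcomplex R)) (- p)%:C =
    (0 : R[i]).
  apply/eqP; rewrite eq_complex /= !mulr0 addr0 eqxx andbT.
  by apply/eqP; rewrite /unstable.onem; field; rewrite gt_eqF// addr_gt0.
move=> /(congr1 (fun z : R[i] => complex.Re `|z|)).
rewrite normc_expC normr0 /= => /eqP.
by rewrite gt_eqF// expR_gt0.
Qed.

Theorem theorem4p14 (R : realType) (alpha : R) (n : nat) (lambda : R[i]) :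
  0 < alpha -> (0 < n)%N -> `|lambda| <= 1 ->
  convex_set (M := Rcomplex R)
    (berezin_range (composition_operator (alpha := alpha)
       (fun z : 'cV[R[i]]_n => lambda%:M *m z))) <->
  exists2 t : R, -1 <= t <= 1 & lambda = t%:C.
Proof.
move=> a0 n0 l1; rewrite berezin_range_scalar//; split => [cvx|[t /andP[_ t1] ->]].
  have [Im0|/nonconvex_spiral//] := eqVneq (complex.Im lambda) 0.
  exists (complex.Re lambda); last by rewrite [LHS]complexE Im0 mulr0 addr0.
  move: l1; rewrite normc_def Im0 expr0n addr0 sqrtr_sqr -[1]/(1%:C) lecR.
  by rewrite ler_norml.
exact: convex_exp_real_ray.
Qed.
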